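(* Let $d\geq1$, $L\ge 1$ to be chosen, and fix a width $p\geq d+3$. For each $j\in\{1,\ldots,d\}$ and $k\in\{1,\ldots,p\}$ let $\{B_{jkr}:r\geq1\}$ be a set of basis functions. Let $\sigma:\mathbb{R}\to\mathbb{R}$ be a non-affine Lipschitz continuous function which is continuously differentiable at at least one point, with nonzero derivative at that point. For $L\geq1$, integers $q_{jk}\geq1$, real numbers $c_{jkr}$, vectors $W_k^{(l)}\in\mathbb{R}^p$ ($2\le l\le L$, $1\le k\le p$), output weights $w_k\in\mathbb{R}$ and biases $b_k^{(l)},b\in\mathbb{R}$, define the HDANN1 function on $[0,1]^d$ by $$x_k^{(1)}=\sigma\Big(\sum_{j=1}^d\sum_{r=1}^{q_{jk}}c_{jkr}B_{jkr}(x_j)+b_k^{(1)}\Big),\quad k=1,\ldots,p,$$ $$x_k^{(l)}=\sigma\big({W_k^{(l)}}^{\top}\mathbf{x}^{(l-1)}+b_k^{(l)}\big),\quad k=1,\ldots,p,\ l=2,\ldots,L,$$ where $\mathbf{x}^{(l)}=(x_1^{(l)},\ldots,x_p^{(l)})^\top$, and output $\mathrm{HDANN1}(\mathbf{x})=\sum_{k=1}^p w_kx_k^{(L)}+b$. Then for any continuous $f:[0,1]^d\to\mathbb{R}$ and any $\epsilon>0$ there exist $L\geq1$, $q_{jk}\geq1$, $W_k^{(l)}\in\mathbb{R}^p$, $w_k\in\mathbb{R}$ and $c_{jkr},b_k^{(l)},b\in\mathbb{R}$ such that $$\sup_{\mathbf{x}\in[0,1]^d}|f(\mathbf{x})-\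mathrm{HDANN1}(\mathbf{x})|<\epsilon.$$
   Context: A set $\{B_r:[0,1]\to\mathbb{R}\,|\,r\geq1\}$ of functions is called a set of basis functions if for every continuous $\phi:[0,1]\to\mathbb{R}$ and every $\epsilon>0$ there exist $q\geq1$ and $c_1,\ldots,c_q,c\in\mathbb{R}$ with $\sup_{x\in[0,1]}|\phi(x)-(\sum_{r=1}^q c_rB_r(x)+c)|<\epsilon$. *)

(* Defs.v *)
From HB Require Import structures.
From mathcomp Require Import all_boot all_order all_algebra.
From mathcomp Require Import all_classical all_reals all_analysis.
Set Implicit Arguments. Unset Strict Implicit. Unset Printing Implicit Defensive.
Import Order.TTheory GRing.Theory Num.Theory.
Import numFieldNormedType.Exports.
Local Open Scope classical_set_scope.
Local Open Scope ring_scope.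

Definition sup_dist {R : realType} {T : Type} (A : set T) (f g : T -> R) : \bar R :=
  ereal_sup [set (`|f x - g x|)%:E | x in A].

Definition unit_interval {R : realType} : set R := [set x : R | 0 <= x <= 1].

Definition basis_functions {R : realType} (B : nat -> R -> R) : Prop :=
  forall phi : R -> R, {within (@unit_interval R), continuous phi} ->
  forall eps : R, 0 < eps ->
  exists q : nat, (1 <= q)%N /\ exists (c : nat -> R) (c0 : R),
    (sup_dist unit_interval phi
       (fun x => (\sum_(1 <= r < q.+1) c r * B r x + c0)%R) < eps%:E)%E.

Definition unit_cube {R : realType} (d : nat) : set 'rV[R]_d :=
  [set x | forall j : 'I_d, 0 <= x ord0 j <= 1].

Definition affine_fun {R : realType} (s : R -> R) : Prop :=
  exists a b : R, forall x, s x = a * x + b.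

Definition lipschitz_fun {R : realType} (s : R -> R) : Prop :=
  exists K : R, forall x y, `|s x - s y| <= K * `|x - y|.

Definition C1_at_nonzero_deriv {R : realType} (s : R -> R) : Prop :=
  exists x0 : R,
    (\forall x \near x0, derivable s x 1) /\
    {for x0, continuous (derive1 s)} /\ derive1 s x0 != 0.

(* Hidden layer x^{(m+1)} of the HDANN1 network (layer index m+1). *)
Fixpoint hdann1_layer {R : realType} (d p : nat) (sigma : R -> R)
    (B : 'I_d -> 'I_p -> nat -> R -> R) (q : 'I_d -> 'I_p -> nat)
    (c : 'I_d -> 'I_p -> nat -> R)
    (W : nat -> 'I_p -> 'I_p -> R) (bias : nat -> 'I_p -> R)
    (x : 'rV[R]_d) (m : nat) : 'I_p -> R :=
  match m with
  | 0%N => fun k => sigma (\sum_(j < d) \sum_(1 <= r < (q j k).+1)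
                           c j k r * B j k r (x ord0 j) + bias 1%N k)
  | m'.+1 => fun k => sigma (\sum_(i < p) W m.+1 k i *
                 hdann1_layer sigma B q c W bias x m' i + bias m.+1 k)
  end.

(* HDANN1(x) = sum_k w_k x_k^{(L)} + b ;
   W l k i = i-th entry of W_k^{(l)}, bias l k = b_k^{(l)} *)
Definition HDANN1 {R : realType} (d p : nat) (sigma : R -> R)
    (B : 'I_d -> 'I_p -> nat -> R -> R) (L : nat) (q : 'I_d -> 'I_p -> nat)
    (c : 'I_d -> 'I_p -> nat -> R)
    (W : nat -> 'I_p -> 'I_p -> R) (bias : nat -> 'I_p -> R)
    (w : 'I_p -> R) (b : R) (x : 'rV[R]_d) : R :=
  \sum_(k < p) w k * hdann1_layer sigma B q c W bias x L.-1 k + b.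

(* Main.v *)
Require Import Defs.
From HB Require Import structures.
From mathcomp Require Import all_boot all_order all_algebra.
From mathcomp Require Import all_classical all_reals all_analysis.
From mathcomp Require Import ring lra zify.
Set Implicit Arguments.
Unset Strict Implicit.
Unset Printing Implicit Defensive.
Import Order.TTheory GRing.Theory Num.Theory.
Import numFieldNormedType.Exports.
Local Open Scope classical_set_scope.
Local Open Scope ring_scope.

(* A Lipschitz function that is not affine has nonvanishing finite differences
   of every order. Differentiating Riemann sums of sigma (a t + b) in the weight
   a then shows that every monomial t^k is a locally uniform limit of linear
   combinations of translates and dilates of sigma, and Taylor expansion gives
   the exponential. The sums of exp (w.x + b) form an algebra whose uniform
   closure is a lattice containing the coordinates, hence it contains every
   continuous function on the cube; so f is close to a shallow network
   sum_i c_i sigma (w_i.x + b_i). A deep network of width d + 2 evaluates this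
   sum one term per layer: d units carry the coordinates, one computes the
   current term and one accumulates the sum. The carrying units use that
   (sigma (x0 + h t) - sigma x0) / (h sigma' x0) tends to t as h tends to 0. *)

(** * Uniformly closed spans *)

Section ClosedSpan.
Context {R : realType}.

(* The uniform closure on [C] of the linear span of [G]. In [cspan_lim] the
   approximants are given as a family indexed by the error, which keeps the
   induction principle usable. *)
Inductive cspan {T I : Type} (C : set T) (G : I -> T -> R) : (T -> R) -> Prop :=
| cspan_gen i : cspan C G (G i)
| cspan0 : cspan C G (fun=> 0)
| cspan_lin a f g :
    cspan C G f -> cspan C G g -> cspan C G (fun x => a * f x + g x)
| cspan_lim f (g : R -> T -> R) :
    (forall e, 0 < e -> cspan C G (g e)) ->
    (forall e x, 0 < e -> C x -> `|f x - g e x| <= e) -> cspan C G f.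

Section Linear.
Context {T I : Type}.
Variables (C : set T) (G : I -> T -> R).
Implicit Types f g : T -> R.

Lemma cspan_closed f :
  (forall e, 0 < e ->
    exists g, cspan C G g /\ forall x, C x -> `|f x - g x| <= e) ->
  cspan C G f.
Proof.
move=> H.
have /choice[g gP] : forall e : R, exists g,
    0 < e -> cspan C G g /\ forall x, C x -> `|f x - g x| <= e.
  move=> e; have [e0|_] := ltP 0 e; last by exists f.
  by have [g ?] := H e e0; exists g.
by apply: (@cspan_lim _ _ C G f g) => [e /gP[]|e x /gP[_]]; last exact.
Qed.

Lemma cspan_ext f g :
  cspan C G f -> (forall x, C x -> g x = f x) -> cspan C G g.
Proof.
move=> Hf E; apply: cspan_closed => e e0; exists f; split=> // x Cx.
by rewrite E // subrr normr0 ltW.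
Qed.

Lemma cspanZ a f : cspan C G f -> cspan C G (fun x => a * f x).
Proof.
by move=> Hf; apply: (cspan_ext (cspan_lin a Hf (cspan0 C G))) => x _; rewrite addr0.
Qed.

Lemma cspanD f g : cspan C G f -> cspan C G g -> cspan C G (fun x => f x + g x).
Proof.
by move=> Hf Hg; apply: (cspan_ext (cspan_lin 1 Hf Hg)) => x _; rewrite mul1r.
Qed.

Lemma cspanB f g : cspan C G f -> cspan C G g -> cspan C G (fun x => f x - g x).
Proof.
by move=> Hf Hg; apply: (cspan_ext (cspan_lin (-1) Hg Hf)) => x _; rewrite mulN1r addrC.
Qed.

Lemma cspan_sum (J : Type) (r : seq J) (F : J -> T -> R) :
  (forall j, cspan C G (F j)) -> cspan C G (fun x => \sum_(j <- r) F j x).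
Proof.
move=> HF; elim: r => [|j r IHr].
  by apply: (cspan_ext (cspan0 C G)) => x _; rewrite big_nil.
by apply: (cspan_ext (cspanD (HF j) IHr)) => x _; rewrite big_cons.
Qed.

(** The converse of closure: a limit spends half of the error on an approximant and half on its
    finite sum. *)
Lemma cspan_finite f : cspan C G f -> forall e, 0 < e ->
  exists s : seq (R * I), forall x, C x ->
    `|f x - \sum_(u <- s) u.1 * G u.2 x| <= e.
Proof.
elim=> [i|| a {}f g _ IHf _ IHg | {}f g _ IHg fg] e e0.
- by exists [:: (1, i)] => x _; rewrite big_seq1 mul1r subrr normr0 ltW.
- by exists [::] => x _; rewrite big_nil subrr normr0 ltW.
- have a1 : 0 < 2 * (`|a| + 1) by rewrite mulr_gt0 // ltr_wpDl.
  have [s sP] := IHf (e / (2 * (`|a| + 1))) (divr_gt0 e0 a1).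
  have [t tP] := IHg (e / 2) (divr_gt0 e0 (ltr0n _ 2)).
  exists ([seq (a * u.1, u.2) | u <- s] ++ t) => x Cx.
  rewrite big_cat big_map /=.
  under eq_bigr do rewrite -mulrA.
  rewrite -mulr_sumr opprD addrACA -mulrBr.
  rewrite (le_trans (ler_normD _ _)) // normrM [leRHS]splitr lerD ?tP //.
  apply: (le_trans (ler_wpM2l (normr_ge0 a) (sP x Cx))).
  rewrite mulrA ler_pdivrMr //.
  have -> : e / 2 * (2 * (`|a| + 1)) = `|a| * e + e by field.
  by rewrite lerDl ltW.
- have e2 : 0 < e / 2 by rewrite divr_gt0.
  have [s sP] := IHg _ e2 _ e2; exists s => x Cx.
  rewrite -(subrKA (g (e / 2) x)) (le_trans (ler_normD _ _)) //.
  by rewrite [leRHS]splitr lerD ?fg ?sP.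
Qed.

End Linear.

(** Substitutes one family of generators into another; chained, it leads from exponentials to
    monomials to [sigma]. *)
Lemma cspan_comp (T T' I I' : Type) (C : set T) (C' : set T')
    (G : I -> T -> R) (G' : I' -> T' -> R) (phi : T' -> T) (f : T -> R) :
  (forall x, C' x -> C (phi x)) ->
  (forall i, cspan C' G' (fun x => G i (phi x))) ->
  cspan C G f -> cspan C' G' (fun x => f (phi x)).
Proof.
move=> CC' HG; elim=> [//|| a {}f g _ IHf _ IHg | {}f g _ IHg fg].
- exact: cspan0.
- exact: cspan_lin.
- apply: cspan_closed => e e0; exists (fun x => g e (phi x)); split.
    exact: IHg.
  by move=> x /CC' Cx; exact: fg.
Qed.

(** * Products, absolute values and maxima in the closure of an algebra *)

Section Algebra.
Context {T I : Type}.
Variables (C : set T) (G : I -> T -> R).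
Hypothesis Gbounded : forall i, exists M, forall x, C x -> `|G i x| <= M.
Hypothesis Gmul : forall i j, exists k, forall x, G i x * G j x = G k x.
Hypothesis Gone : exists i, forall x, G i x = 1.
Implicit Types f g : T -> R.

Lemma cspan_bounded f :
  cspan C G f -> exists2 M, 0 < M & forall x, C x -> `|f x| <= M.
Proof.
elim=> [i|| a {}f g _ [M M0 HM] _ [N N0 HN] | {}f g _ IHg fg].
- have [M HM] := Gbounded i; exists (`|M| + 1); first by rewrite ltr_wpDl.
  move=> x Cx; apply: (le_trans (HM _ Cx)).
  by rewrite (le_trans (ler_norm M)) // lerDl.
- by exists 1 => // x _; rewrite normr0.
- exists (`|a| * M + N); first by rewrite ltr_wpDl // mulr_ge0 // ltW.
  move=> x Cx; rewrite (le_trans (ler_normD _ _)) // normrM.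
  by rewrite lerD ?HN // ler_wpM2l ?HM.
- have [M M0 HM] := IHg 1 ltr01; exists (1 + M); first by rewrite ltr_wpDl.
  move=> x Cx; rewrite -(subrK (g 1 x) (f x)) (le_trans (ler_normD _ _)) //.
  by rewrite lerD ?fg ?HM.
Qed.

Lemma cspan_cst a : cspan C G (fun=> a).
Proof.
have [i Hi] := Gone.
by apply: (cspan_ext (cspanZ a (cspan_gen C G i))) => x _; rewrite Hi mulr1.
Qed.

Lemma cspanM_lim f (g : R -> T -> R) h :
  cspan C G h -> (forall e, 0 < e -> cspan C G (fun x => h x * g e x)) ->
  (forall e x, 0 < e -> C x -> `|f x - g e x| <= e) ->
  cspan C G (fun x => h x * f x).
Proof.
move=> Hh Hg fg; have [M M0 HM] := cspan_bounded Hh.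
apply: cspan_closed => e e0; exists (fun x => h x * g (e / M) x).
split=> [|x Cx]; first by apply: Hg; rewrite divr_gt0.
rewrite -mulrBr normrM -[leRHS](divfK (lt0r_neq0 M0)) [leRHS]mulrC.
by rewrite ler_pM ?HM ?fg // divr_gt0.
Qed.

(** Induction on one factor, a generator being handled first. Boundedness of the fixed factor
    carries products through uniform limits. *)
Lemma cspanM f g : cspan C G f -> cspan C G g -> cspan C G (fun x => f x * g x).
Proof.
have genM i h : cspan C G h -> cspan C G (fun x => G i x * h x).
  elim=> [j|| a {}f {}g _ IHf _ IHg | {}f {}g _ IHg fg].
  - by have [k Hk] := Gmul i j; apply: (cspan_ext (cspan_gen C G k)).
  - by apply: (cspan_ext (cspan0 C G)) => x _; rewrite mulr0.
  - by apply: (cspan_ext (cspan_lin a IHf IHg)) => x _; rewrite mulrDr mulrCA.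
  - by apply: (cspanM_lim (cspan_gen C G i) IHg fg).
move=> + Hg; elim=> [i|| a {}f h _ IHf _ IHh | {}f h _ IHh fh].
- exact: genM.
- by apply: (cspan_ext (cspan0 C G)) => x _; rewrite mul0r.
- by apply: (cspan_ext (cspan_lin a IHf IHh)) => x _; rewrite mulrDl mulrA.
- apply: (@cspan_ext _ _ _ _ (fun x => g x * f x)) => [|x _]; last exact: mulrC.
  apply: (cspanM_lim Hg _ fh) => e e0.
  by apply: (cspan_ext (IHh e e0)) => x _; exact: mulrC.
Qed.

(* Polynomials in [s ^+ 2] that increase to [s] on [[0, 1]]. *)
Fixpoint sqrt_iter (n : nat) (y : R) : R :=
  if n is m.+1 then sqrt_iter m y + (y - sqrt_iter m y ^+ 2) / 2 else 0.

(** The error shrinks by the factor [1 - (s + p) / 2] at each step; the second bound gives an error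
    of at most [2 / n] for [n > 0], uniformly in [s]. *)
Lemma sqrt_iter_bound (s : R) n : 0 <= s <= 1 ->
  0 <= sqrt_iter n (s ^+ 2) <= s /\
  (s - sqrt_iter n (s ^+ 2)) * (1 + n%:R * (s / 2)) <= s.
Proof.
move=> /andP[s0 s1]; elim: n => [|n [/andP[p0 ps] IHn]] /=.
  by rewrite lexx s0 mul0r addr0 mulr1 subr0.
set p := sqrt_iter n _ in p0 ps IHn *.
have E : s - (p + (s ^+ 2 - p ^+ 2) / 2) = (s - p) * (1 - (s + p) / 2) by field.
have n0 : 0 <= n%:R * (s / 2) :> R by rewrite mulr_ge0 // divr_ge0.
have sp : 0 <= s - p by lra.
split; first by apply/andP; split; [nra|rewrite -subr_ge0 E mulr_ge0 //; lra].
rewrite E; apply: le_trans IHn.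
rewrite -mulrA ler_wpM2l // -(natr1 n); set N := n%:R in n0 *.
have pN : 0 <= (1 + N * (s / 2)) * p by rewrite mulr_ge0 // addr_ge0.
have sN : 0 <= N * (s / 2) * s by rewrite mulr_ge0.
have [ss sp'] : 0 <= s * s /\ 0 <= s * p by rewrite !mulr_ge0.
rewrite -subr_ge0.
have -> : 1 + N * (s / 2) - (1 - (s + p) / 2) * (1 + (N + 1) * (s / 2)) =
  ((1 + N * (s / 2)) * p + N * (s / 2) * s + s * s / 2 + s * p / 2) / 2 by field.
lra.
Qed.

(** |f| is [M] times the square root of [(f / M) ^+ 2], where dividing by the bound [M] brings
    values into the range of [sqrt_iter_bound]. *)
Lemma cspan_norm f : cspan C G f -> cspan C G (fun x => `|f x|).
Proof.
move=> Hf; have [M M0 HM] := cspan_bounded Hf.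
have M0' := lt0r_neq0 M0.
have Hp n : cspan C G (fun x => sqrt_iter n ((f x / M) ^+ 2)).
  elim: n => [|n IHn] /=; first exact: cspan0.
  apply: (cspanD IHn).
  apply: (@cspan_ext _ _ _ _ (fun x => 2^-1 * ((M^-1 * f x) * (M^-1 * f x) -
     sqrt_iter n ((f x / M) ^+ 2) * sqrt_iter n ((f x / M) ^+ 2)))).
    apply: cspanZ; apply: cspanB; last exact: cspanM.
    by apply: cspanM; apply: cspanZ.
  by move=> x _; rewrite -!expr2 mulrC [f x / M]mulrC.
apply: cspan_closed => e e0.
(* The iteration error is at most [2 / n], which [M] multiplies. *)
pose n := Num.bound (2 * M / e).
exists (fun x => M * sqrt_iter n ((f x / M) ^+ 2)); split; first exact: cspanZ.
move=> x Cx.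
have s01 : 0 <= `|f x / M| <= 1.
  by rewrite normr_ge0 /= normrM normfV (gtr0_norm M0) ler_pdivrMr // mul1r HM.
have [] := sqrt_iter_bound n s01; rewrite real_normK ?num_real //.
set p := sqrt_iter n _; set s := `|f x / M| in s01 * => /andP[p0 ps] H.
have -> : `|f x| = M * s.
  by rewrite /s normrM normfV (gtr0_norm M0) mulrC divfK.
rewrite -mulrBr normrM (gtr0_norm M0) ger0_norm ?subr_ge0 //.
have n0 : 0 < n%:R :> R.
  have := @archi_boundP R (2 * M / e); rewrite -/n => H'.
  apply: le_lt_trans (H' _); by rewrite divr_ge0 ?mulr_ge0 ?ltW.
have nM : 2 * M < n%:R * e.
  rewrite -ltr_pdivrMr //; apply: archi_boundP.
  by rewrite divr_ge0 ?mulr_ge0 ?ltW.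
case/andP: s01 => s0 s1; have [sz|sN] := eqVneq s 0.
  by rewrite sz in ps *; nra.
have {}s0 : 0 < s by rewrite lt_neqAle eq_sym sN.
have H2 : (s - p) * (n%:R / 2) <= 1.
  rewrite -(ler_pM2r s0) mul1r; apply: le_trans H.
  rewrite -mulrA ler_wpM2l ?subr_ge0 //; lra.
have H3 : (s - p) * M <= (s - p) * (n%:R * e / 2).
  by rewrite ler_wpM2l ?subr_ge0 //; lra.
have -> : M * (s - p) = (s - p) * M by rewrite mulrC.
apply: le_trans H3 _.
have -> : (s - p) * (n%:R * e / 2) = e * ((s - p) * (n%:R / 2)) by field.
by rewrite -[leRHS]mulr1 ler_wpM2l // ltW.
Qed.

Lemma cspan_max f g :
  cspan C G f -> cspan C G g -> cspan C G (fun x => Num.max (f x) (g x)).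
Proof.
move=> Hf Hg.
have H := cspanZ 2^-1 (cspanD (cspanD Hf Hg) (cspan_norm (cspanB Hf Hg))).
apply: (cspan_ext H) => x _.
by rewrite maxr_absE mulrC.
Qed.

End Algebra.
End ClosedSpan.

(** * Monomials from a Lipschitz non-affine function *)

Section Monomials.
Context {R : realType}.
Implicit Types (g sigma : R -> R) (h t u v : R).

Definition fdiff h g : R -> R := fun t => g (t + h) - g t.

Lemma lipschitz_fun_ge0 g : lipschitz_fun g ->
  exists2 K, 0 <= K & forall x y, `|g x - g y| <= K * `|x - y|.
Proof.
move=> [K HK]; exists `|K| => // x y; apply: (le_trans (HK x y)).
by rewrite ler_wpM2r // ler_norm.
Qed.

Lemma fdiff_lipschitz h g : lipschitz_fun g -> lipschitz_fun (fdiff h g).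
Proof.
move=> [K HK]; exists (K + K) => x y; rewrite /fdiff.
have -> : g (x + h) - g x - (g (y + h) - g y) =
  (g (x + h) - g (y + h)) + (g y - g x) by ring.
rewrite mulrDl (le_trans (ler_normD _ _)) // lerD //.
  by rewrite (le_trans (HK _ _)) // opprD addrACA subrr addr0.
by rewrite (le_trans (HK _ _)) // distrC.
Qed.

Lemma iter_fdiff_lipschitz k h g :
  lipschitz_fun g -> lipschitz_fun (iter k (fdiff h) g).
Proof. by move=> Hg; elim: k => //= k; exact: fdiff_lipschitz. Qed.

(** * Riemann sums and their increments *)

Section RiemannSum.
Variables (g : R -> R) (K dl : R) (N : nat).
Hypothesis K0 : 0 <= K.
Hypothesis gK : forall x y, `|g x - g y| <= K * `|x - y|.
Hypothesis dl0 : 0 < dl.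
Let h := N%:R * dl.
Let S u := \sum_(i < N) dl * g (u + i%:R * dl).

Let fdiffB u v : `|fdiff h g (u + v) - fdiff h g u| <= 2 * K * `|v|.
Proof.
rewrite /fdiff.
have -> : g (u + v + h) - g (u + v) - (g (u + h) - g u) =
  (g (u + v + h) - g (u + h)) + (g u - g (u + v)) by ring.
have -> : 2 * K * `|v| = K * `|v| + K * `|v| by ring.
rewrite (le_trans (ler_normD _ _)) // lerD //.
  rewrite (le_trans (gK _ _)) // ler_wpM2l //.
  by have -> : u + v + h - (u + h) = v by ring.
rewrite (le_trans (gK _ _)) // ler_wpM2l //.
have -> : u - (u + v) = - v by ring.
by rewrite normrN.
Qed.

(** The sum telescopes: a shift by one mesh width only changes the two end terms. *)
Let riemann_shift u : S (u + dl) - S u = dl * fdiff h g u.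
Proof.
rewrite /S /fdiff /h; elim: N => [|n IHn].
  by rewrite !big_ord0 mul0r addr0 !subrr mulr0.
rewrite !big_ord_recr /= opprD addrACA IHn.
have -> : u + dl + n%:R * dl = u + n.+1%:R * dl by rewrite -natr1; ring.
ring.
Qed.

(** At each single shift, [fdiff h g] has drifted by at most [2 * K] times the distance covered. *)
Let riemann_shiftn u m :
  `|S (u + m%:R * dl) - S u - m%:R * dl * fdiff h g u| <=
  2 * K * (m%:R * dl) ^+ 2.
Proof.
elim: m => [|m IHm].
  by rewrite !mul0r addr0 subrr subr0 normr0 expr0n mulr0.
have -> : u + m.+1%:R * dl = u + m%:R * dl + dl by rewrite -natr1; ring.
set a := m%:R * dl in IHm *.
have -> : S (u + a + dl) - S u - m.+1%:R * dl * fdiff h g u =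
  (S (u + a) - S u - a * fdiff h g u) +
  dl * (fdiff h g (u + a) - fdiff h g u).
  have -> : S (u + a + dl) = dl * fdiff h g (u + a) + S (u + a).
    by rewrite -riemann_shift subrK.
  by rewrite -natr1 /a; ring.
have a0 : 0 <= a by rewrite mulr_ge0 // ltW.
rewrite (le_trans (ler_normD _ _)) //.
have H : `|dl * (fdiff h g (u + a) - fdiff h g u)| <= dl * (2 * K * a).
  rewrite normrM (gtr0_norm dl0) ler_wpM2l ?(ltW dl0) //.
  by rewrite (le_trans (fdiffB _ _)) // (ger0_norm a0).
apply: (le_trans (lerD IHm H)).
have -> : m.+1%:R * dl = a + dl by rewrite -(natr1 m) /a; ring.
rewrite -subr_ge0.
have -> : 2 * K * (a + dl) ^+ 2 - (2 * K * a ^+ 2 + dl * (2 * K * a)) =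
  2 * K * (dl * a + dl ^+ 2) by ring.
by rewrite !mulr_ge0 ?addr_ge0 ?exprn_ge0 ?mulr_ge0 // ltW.
Qed.

Let riemann_lip u v : `|S (u + v) - S u| <= h * (K * `|v|).
Proof.
rewrite /S -sumrB (le_trans (ler_norm_sum _ _ _)) //.
have -> : h * (K * `|v|) = \sum_(i < N) dl * (K * `|v|).
  by rewrite sumr_const card_ord -mulr_natl /h -mulrA.
apply: ler_sum => i _; rewrite -mulrBr normrM (gtr0_norm dl0).
rewrite ler_wpM2l ?(ltW dl0) // (le_trans (gK _ _)) // ler_wpM2l //.
by have -> : u + v + i%:R * dl - (u + i%:R * dl) = v by ring.
Qed.

Let fdiff_le u : `|fdiff h g u| <= K * h.
Proof.
rewrite (le_trans (gK _ _)) // ler_wpM2l // addrC addKr ger0_norm //.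
by rewrite mulr_ge0 // ltW.
Qed.

Let riemann_increment_pos u v : 0 <= v ->
  `|S (u + v) - S u - v * fdiff h g u| <= 2 * K * v ^+ 2 + 2 * K * h * dl.
Proof.
(* [v] is rounded down to the mesh; the remainder, less than [dl], costs [K * h * dl] in each of
   [H1] and [H3]. *)
move=> v0; pose m := Num.truncn (v / dl).
have /truncn_itv/andP[] : 0 <= v / dl by rewrite divr_ge0 // ltW.
rewrite -/m ler_pdivlMr // ltr_pdivrMr // => m1 m2.
set a := m%:R * dl in m1 *.
have {}m2 : v - a < dl.
  by move: m2; rewrite -natr1 mulrDl mul1r -/a; lra.
have -> : S (u + v) - S u - v * fdiff h g u =
  (S (u + a + (v - a)) - S (u + a)) + (S (u + a) - S u - a * fdiff h g u)
  - (v - a) * fdiff h g u.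
  by rewrite -[u + a + _]addrA subrKC; ring.
have a0 : 0 <= a by rewrite mulr_ge0 // ltW.
have h0 : 0 <= h by rewrite mulr_ge0 // ltW.
have Kh : 0 <= K * h by rewrite mulr_ge0.
have H1 : `|S (u + a + (v - a)) - S (u + a)| <= K * h * dl.
  rewrite (le_trans (riemann_lip _ _)) // (ger0_norm (x := v - a)) ?subr_ge0 //.
  by rewrite mulrA [h * K]mulrC ler_wpM2l // ltW.
have H2 : `|S (u + a) - S u - a * fdiff h g u| <= 2 * K * v ^+ 2.
  rewrite (le_trans (riemann_shiftn _ _)) // ler_wpM2l ?mulr_ge0 //.
  by rewrite ler_sqr ?nnegrE // (le_trans a0).
have H3 : `|(v - a) * fdiff h g u| <= K * h * dl.
  rewrite normrM (ger0_norm (x := v - a)) ?subr_ge0 // mulrC.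
  by rewrite ler_pM ?subr_ge0 ?fdiff_le // ltW.
rewrite (le_trans (ler_normB _ _)) //.
have := ler_normD (S (u + a + (v - a)) - S (u + a)) (S (u + a) - S u - a * fdiff h g u).
lra.
Qed.

(* A Riemann sum of [g] over [[u, u + h]] behaves like its integral: its
   derivative in [u] is the finite difference [fdiff h g u]. *)
Lemma riemann_increment u v :
  `|S (u + v) - S u - v * fdiff h g u| <= 4 * K * v ^+ 2 + 2 * K * h * dl.
Proof.
have Kv : 0 <= K * v ^+ 2 by rewrite mulr_ge0 // sqr_ge0.
have [v0|v0] := leP 0 v.
  by apply: (le_trans (riemann_increment_pos u v0)); lra.
(* The increment is read backwards from [u + v]; moving [fdiff h g] back to [u] costs another
   [2 * K * v ^+ 2]. *)
have := @riemann_increment_pos (u + v) (- v) ltac:(lra); rewrite addrK => H.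
have -> : S (u + v) - S u - v * fdiff h g u =
  - (S u - S (u + v) - - v * fdiff h g (u + v))
  + v * (fdiff h g (u + v) - fdiff h g u) by ring.
have H2 : `|v * (fdiff h g (u + v) - fdiff h g u)| <= 2 * K * v ^+ 2.
  rewrite normrM -[v ^+ 2]real_normK ?num_real // expr2 mulrCA.
  by rewrite ler_wpM2l // fdiffB.
rewrite (le_trans (ler_normD _ _)) // normrN; rewrite sqrrN in H.
by move: H H2; lra.
Qed.

End RiemannSum.

Section Step.
Variables (I : Type) (G : I -> R -> R) (M : R).
Hypothesis M0 : 0 < M.
Let C : set R := [set t | `|t| <= M].

(* Differentiating in [a] the Riemann sums of [t ^+ k * g (a * t + b)] over
   [b] raises the power of [t]. *)
Lemma cspan_raise_power k g h : lipschitz_fun g -> 0 < h ->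
  (forall a b, cspan C G (fun t => t ^+ k * g (a * t + b))) ->
  forall a b, cspan C G (fun t => t ^+ k.+1 * fdiff h g (a * t + b)).
Proof.
move=> /lipschitz_fun_ge0[K K0 gK] h0 Hg a b; apply: cspan_closed => e e0.
(* [P * eta] is the quadratic error divided by [eta], [Q / N%:R] the mesh error; first [eta], then
   [N], makes each at most [e / 2]. *)
pose P := M ^+ k * (4 * K * M ^+ 2).
have P0 : 0 <= P by rewrite !mulr_ge0 ?exprn_ge0 // ltW.
pose eta := e / (2 * (P + 1)).
have P1 : 0 < 2 * (P + 1) by rewrite mulr_gt0 // ltr_wpDl.
have eta0 : 0 < eta by rewrite divr_gt0.
have etaP : P * eta <= e / 2.
  rewrite /eta mulrA ler_pdivrMr //.
  have -> : e / 2 * (2 * (P + 1)) = P * e + e by field.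
  by rewrite lerDl ltW.
pose Q := M ^+ k * (eta^-1 * (2 * K * h * h)).
have Q0 : 0 <= Q.
  apply: mulr_ge0; first by rewrite exprn_ge0 // ltW.
  by apply: mulr_ge0; [rewrite invr_ge0 ltW|rewrite !mulr_ge0 // ltW].
have Qe : 0 <= 2 * Q / e by apply: divr_ge0 (ltW e0); apply: mulr_ge0.
pose N := Num.bound (2 * Q / e).
have QN : 2 * Q / e < N%:R by exact: archi_boundP.
have N0 : 0 < N%:R :> R by exact: le_lt_trans QN.
pose dl := h / N%:R.
have dl0 : 0 < dl by rewrite divr_gt0.
have hE : N%:R * dl = h by rewrite mulrC divfK // lt0r_neq0.
pose S u := \sum_(i < N) dl * g (u + i%:R * dl).
have HS a' : cspan C G (fun t => t ^+ k * S (a' * t + b)).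
  apply: (@cspan_ext _ _ _ _ _ (fun t => \sum_(i < N)
     dl * (t ^+ k * g (a' * t + (b + i%:R * dl))))).
    by apply: cspan_sum => i; apply: cspanZ.
  move=> t _; rewrite /S mulr_sumr; apply: eq_bigr => i _.
  by rewrite mulrCA addrA.
exists (fun t => eta^-1 *
  (t ^+ k * S ((a + eta) * t + b) - t ^+ k * S (a * t + b))); split.
  by apply: cspanZ; apply: cspanB.
move=> t Ct; set u := a * t + b.
have -> : (a + eta) * t + b = u + eta * t by rewrite /u; ring.
have := riemann_increment N K0 gK dl0 u (eta * t); rewrite hE -/(S _) -/(S _).
set D := fdiff h g u => H.
have -> : t ^+ k.+1 * D - eta^-1 * (t ^+ k * S (u + eta * t) - t ^+ k * S u) =
  - (t ^+ k * (eta^-1 * (S (u + eta * t) - S u - eta * t * D))).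
  by rewrite exprS; field; rewrite lt0r_neq0.
rewrite normrN normrM normrX [`|eta^-1 * _|]normrM (gtr0_norm (x := eta^-1)) ?invr_gt0 //.
have Mk : `|t| ^+ k <= M ^+ k by rewrite lerXn2r ?nnegrE // ltW.
have tM : t ^+ 2 <= M ^+ 2.
  by rewrite -[t ^+ 2]real_normK ?num_real // lerXn2r ?nnegrE // ltW.
apply: (@le_trans _ _ (M ^+ k * (eta^-1 * (4 * K * (eta ^+ 2 * M ^+ 2) + 2 * K * h * dl)))).
  rewrite ler_pM ?exprn_ge0 ?mulr_ge0 ?invr_ge0 ?(ltW eta0) //.
  rewrite ler_wpM2l ?invr_ge0 ?(ltW eta0) // (le_trans H) // lerD2r exprMn.
  by rewrite ler_wpM2l ?mulr_ge0 // ler_wpM2l // sqr_ge0.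
have -> : M ^+ k * (eta^-1 * (4 * K * (eta ^+ 2 * M ^+ 2) + 2 * K * h * dl)) =
  P * eta + Q / N%:R by rewrite /P /Q /dl; field; rewrite !lt0r_neq0.
rewrite [leRHS]splitr lerD // ler_pdivrMr //.
by move: QN; rewrite ltr_pdivrMr //; lra.
Qed.

Lemma cspan_monomial_fdiff k g h : lipschitz_fun g -> 0 < h ->
  (forall a b, cspan C G (fun t => g (a * t + b))) ->
  forall a b, cspan C G (fun t => t ^+ k * iter k (fdiff h) g (a * t + b)).
Proof.
move=> gL h0 Hg; elim: k => [|k IHk] a b.
  by apply: (cspan_ext (Hg a b)) => t _; rewrite expr0 mul1r.
by apply: cspan_raise_power => //; exact: iter_fdiff_lipschitz.
Qed.

End Step.

(** * Finite differences of Lipschitz functions *)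

Lemma natmul_bounded_eq0 (c A : R) : (forall n, n%:R * `|c| <= A) -> c = 0.
Proof.
move=> H; apply/eqP; rewrite -normr_le0 leNgt; apply/negP => c0.
have A0 : 0 <= A by have := H 0%N; rewrite mul0r.
have := archi_boundP (divr_ge0 A0 (ltW c0)).
by rewrite ltr_pdivrMr // ltNge H.
Qed.

(** A difference of order [k.+2] constant equal to [c] along steps [h] makes the one of order [k.+1]
    grow like [n%:R * c]; but that one is bounded, being a single difference of a Lipschitz
    function. *)
Lemma iter_fdiff_eq0_descent k h g : lipschitz_fun g ->
  (forall t, iter k.+3 (fdiff h) g t = 0) ->
  forall t, iter k.+2 (fdiff h) g t = 0.
Proof.
move=> gL H t; set c := LHS.
have cE n : iter k.+2 (fdiff h) g (t + n%:R * h) = c.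
  elim: n => [|n IHn]; first by rewrite mul0r addr0.
  rewrite -IHn -natr1 mulrDl mul1r addrA; apply/eqP.
  by rewrite -subr_eq0; apply/eqP; exact: (H (t + n%:R * h)).
have bE n : iter k.+1 (fdiff h) g (t + n%:R * h) =
            iter k.+1 (fdiff h) g t + n%:R * c.
  elim: n => [|n IHn]; first by rewrite !mul0r !addr0.
  have -> : t + n.+1%:R * h = t + n%:R * h + h by rewrite -natr1; ring.
  have -> : iter k.+1 (fdiff h) g (t + n%:R * h + h) =
    iter k.+2 (fdiff h) g (t + n%:R * h) + iter k.+1 (fdiff h) g (t + n%:R * h).
    by apply: esym; exact: subrK.
  by rewrite cE IHn -natr1; ring.
have [K K0 HK] := lipschitz_fun_ge0 (iter_fdiff_lipschitz k h gL).
have B s : `|iter k.+1 (fdiff h) g s| <= K * `|h|.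
  by rewrite /= {1}/fdiff (le_trans (HK _ _)) // addrC addKr.
apply: (@natmul_bounded_eq0 _ (2 * (K * `|h|))) => n.
rewrite -{1}[n%:R]normr_nat -normrM.
have -> : n%:R * c = iter k.+1 (fdiff h) g (t + n%:R * h) - iter k.+1 (fdiff h) g t.
  by rewrite bE; ring.
by rewrite (le_trans (ler_normB _ _)) // mulr2n mulrDl mul1r lerD.
Qed.

(** Minus the chord through 0 and 1, [g] becomes a Lipschitz [D] with [D (n%:R * x) = n%:R * D x]
    for [x > 0] and zero at the naturals. Comparing with the integer below bounds [n%:R * D x] for
    all [n], so [D x = 0]. *)
Lemma fdiff2_eq0_affine g : lipschitz_fun g ->
  (forall h t, 0 < h -> iter 2 (fdiff h) g t = 0) -> affine_fun g.
Proof.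
move=> /lipschitz_fun_ge0[K K0 HK] H.
pose a := g 1 - g 0; exists a, (g 0).
pose D x := g x - (a * x + g 0).
have D0 : D 0 = 0 by rewrite /D; ring.
have D1 : D 1 = 0 by rewrite /D /a; ring.
have D2 h t : 0 < h -> D (t + h + h) = 2 * D (t + h) - D t.
  by move=> /H-/(_ t); rewrite /= /fdiff /D => /eqP; rewrite subr_eq0 => /eqP; lra.
have Dn x n : 0 < x -> D (n%:R * x) = n%:R * D x.
  move=> x0; suff [-> _] : D (n%:R * x) = n%:R * D x /\
      D (n.+1%:R * x) = n.+1%:R * D x by [].
  elim: n => [|n [IH1 IH2]]; first by rewrite !mul0r !mul1r.
  split=> //; have := @D2 x (n%:R * x) x0.
  have -> : n%:R * x + x + x = n.+2%:R * x by rewrite -!natr1; ring.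
  have -> : n%:R * x + x = n.+1%:R * x by rewrite -!natr1; ring.
  by rewrite IH1 IH2 => ->; rewrite -!natr1; ring.
have DK x y : `|D x - D y| <= (K + `|a|) * `|x - y|.
  have -> : D x - D y = (g x - g y) - a * (x - y) by rewrite /D; ring.
  by rewrite (le_trans (ler_normB _ _)) // normrM [leRHS]mulrDl lerD.
have Dpos x : 0 < x -> D x = 0.
  move=> x0; apply: (@natmul_bounded_eq0 _ (K + `|a|)) => n.
  rewrite -{1}[n%:R]normr_nat -normrM -Dn //.
  pose m := Num.truncn (n%:R * x).
  have /andP[m1 m2] : m%:R <= n%:R * x < m.+1%:R.
    by apply: truncn_itv; rewrite mulr_ge0 // ltW.
  have Dm : D m%:R = 0 by rewrite -[m%:R]mulr1 Dn // D1 mulr0.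
  rewrite -[D _]subr0 -Dm (le_trans (DK _ _)) // -[leRHS]mulr1.
  rewrite ler_wpM2l ?addr_ge0 // ger0_norm ?subr_ge0 //.
  by move: m2; rewrite -natr1; lra.
move=> x; suff : D x = 0 by rewrite /D; lra.
have [x0|x0|->] := ltgtP x 0; [|exact: Dpos|exact: D0].
(* The progression [x], [0], [- x] settles negative [x]. *)
have := @D2 (- x) x ltac:(lra); rewrite subrr add0r D0 Dpos ?oppr_gt0 //; lra.
Qed.

(* On an arithmetic progression a function with vanishing differences of order
   [k] is a polynomial; linear growth forces its degree to be at most one. *)
Lemma iter_fdiff_neq0 k g : lipschitz_fun g -> ~ affine_fun g ->
  exists h t, 0 < h /\ iter k (fdiff h) g t != 0.
Proof.
move=> gL gA; apply: contrapT => H; apply: gA.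
have {}H h : 0 < h -> forall t, iter k (fdiff h) g t = 0.
  move=> h0 t; apply/eqP; apply: contrapT => /negP Ht.
  by apply: H; exists h, t.
apply: fdiff2_eq0_affine => // h t h0.
(* Two extra differences start the descent so that it ends at order two. *)
have {}H : forall t, iter k.+2 (fdiff h) g t = 0.
  by move=> s; rewrite /= /fdiff !H // !subrr.
elim: k H t => // k IHk /(iter_fdiff_eq0_descent gL); exact: IHk.
Qed.

(** Taking [a = 0] and [b = t0] with a nonzero [k]-th difference at [t0] turns that factor into a
    constant to divide by. *)
Lemma cspan_monomial sigma (M : R) (k : nat) : 0 < M ->
  lipschitz_fun sigma -> ~ affine_fun sigma ->
  cspan [set t : R | `|t| <= M]
    (fun (u : R * R) t => sigma (u.1 * t + u.2)) (fun t => t ^+ k).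
Proof.
move=> M0 sL sA; have [h [t0 [h0 nz]]] := iter_fdiff_neq0 k sL sA.
have H := @cspan_monomial_fdiff _ (fun (u : R * R) t => sigma (u.1 * t + u.2))
  M M0 k sigma h sL h0.
have {}H := H (fun a b => cspan_gen _ _ (a, b)) 0 t0.
apply: (cspan_ext (cspanZ (iter k (fdiff h) sigma t0)^-1 H)) => t _.
by rewrite mul0r add0r mulrCA mulVf // mulr1.
Qed.

(** The tail at [t] is dominated term by term by the tail at [M], so convergence at [M] alone is
    uniform for |t| <= M. *)
Lemma expR_taylor_bound (M t : R) n : `|t| <= M ->
  `|expR t - series (exp_coeff t) n| <= expR M - series (exp_coeff M) n.
Proof.
move=> tM.
have c1 : (fun m => `|series (exp_coeff t) m - series (exp_coeff t) n|) @ \oo -->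
    `|expR t - series (exp_coeff t) n|.
  apply: cvg_norm; apply: cvgB; last exact: cvg_cst.
  exact: is_cvg_series_exp_coeff.
have c2 : (fun m => series (exp_coeff M) m - series (exp_coeff M) n) @ \oo -->
    expR M - series (exp_coeff M) n.
  apply: cvgB; last exact: cvg_cst.
  exact: is_cvg_series_exp_coeff.
rewrite -(cvg_lim _ c1) // -(cvg_lim _ c2) //.
apply: ler_lim; [by apply/cvg_ex; eexists; exact: c1|by apply/cvg_ex; eexists; exact: c2|].
exists n => // m /= nm; rewrite !sub_series_geq //.
rewrite (le_trans (ler_norm_sum _ _ _)) //.
apply: ler_sum => i _; rewrite /exp_coeff /= normrM normrX.
rewrite [`|_^-1|]ger0_norm ?invr_ge0 // ler_wpM2r ?invr_ge0 // lerXn2r ?nnegrE //.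
exact: le_trans (normr_ge0 t) tM.
Qed.

Lemma cspan_expR (M : R) :
  cspan [set t : R | `|t| <= M] (fun (k : nat) (t : R) => t ^+ k) expR.
Proof.
apply: cspan_closed => e e0.
have /cvgrPdist_le/(_ e e0)[n _ Hn] := @is_cvg_series_exp_coeff R M.
exists (fun t => series (exp_coeff t) n); split.
  apply: cspan_sum => i /=.
  by apply: (cspan_ext (cspanZ (i`!%:R^-1) (cspan_gen _ _ i))) => t _; rewrite mulrC.
move=> t tM; apply: (le_trans (expR_taylor_bound n tM)).
by apply: (le_trans (ler_norm _)); exact: (Hn n (leqnn n)).
Qed.

End Monomials.

(** * Ridge functions on the cube *)

Section Cube.
Context {R : realType} {d : nat}.
Implicit Types (x y : 'rV[R]_d) (f : 'rV[R]_d -> R) (w : 'I_d -> R).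

Definition ridge (s : R -> R) (u : ('I_d -> R) * R) x : R :=
  s (\sum_j u.1 j * x ord0 j + u.2).

Lemma derivable_recovers_id (s : R -> R) (x0 : R) :
  derivable s x0 1 -> s^`()%classic x0 != 0 ->
  forall M e : R, 0 < M -> 0 < e -> exists A al be, forall t, `|t| <= M ->
    `|al * s (A * t + x0) + be - t| <= e.
Proof.
move=> ds D0 M e M0 e0; set D := s^`()%classic x0 in D0.
have D1 : 0 < `|D| by rewrite normr_gt0.
have cD : (fun h : R => h^-1 *: (s (h + x0) - s x0)) @ 0^' --> D.
  have -> : (fun h : R => h^-1 *: (s (h + x0) - s x0)) =
     (fun h : R => h^-1 *: ((s \o shift x0) (h *: 1) - s x0)).
    by apply/funext => h /=; rewrite /GRing.scale /= mulr1.
  by rewrite /D derive1E; exact: ds.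
(* This error is later multiplied by [t / D], at most M / |D| in absolute value. *)
have e'0 : 0 < e * `|D| / M by rewrite !mulr_gt0 // invr_gt0.
move/cvgrPdist_le : cD => /(_ _ e'0)[dl /= dl0 Hdl].
pose A := dl / (2 * M).
have A0 : 0 < A by rewrite divr_gt0 // mulr_gt0.
exists A, (A * D)^-1, (- (s x0 / (A * D))) => t tM.
have [->|t0] := eqVneq t 0.
  by rewrite mulr0 add0r mulrC !subrr normr0 ltW.
have At0 : A * t != 0 by rewrite mulf_neq0 // lt0r_neq0.
have /Hdl : `|0 - A * t| < dl.
  rewrite sub0r normrN normrM (gtr0_norm A0).
  apply: (@le_lt_trans _ _ (A * M)); first by rewrite ler_pM2l.
  have -> : A * M = dl / 2 by rewrite /A; field; rewrite lt0r_neq0.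
  by lra.
move=> /(_ At0); rewrite /GRing.scale /=; set q := s _ - s x0 => H.
have -> : (A * D)^-1 * s (A * t + x0) - s x0 / (A * D) - t =
  - (t / D * (D - (A * t)^-1 * q)).
  by rewrite /q; field; rewrite D0 t0 (lt0r_neq0 A0).
rewrite normrN normrM.
apply: (@le_trans _ _ (M / `|D| * (e * `|D| / M))).
  rewrite ler_pM // normrM normfV ler_wpM2r // invr_ge0 ltW //.
have -> // : M / `|D| * (e * `|D| / M) = e.
by field; rewrite !lt0r_neq0.
Qed.

Lemma ridge_arg_bound w (b : R) x : @unit_cube R d x ->
  `|\sum_j w j * x ord0 j + b| <= \sum_j `|w j| + `|b|.
Proof.
move=> Cx; rewrite (le_trans (ler_normD _ _)) // lerD2r.
rewrite (le_trans (ler_norm_sum _ _ _)) //; apply: ler_sum => j _.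
have /andP[x0 x1] := Cx j.
by rewrite normrM (ger0_norm x0) ler_piMr.
Qed.

(** * Density of exponential sums on the cube *)

Section Exponentials.
Let C := @unit_cube R d.
Let E := ridge expR.

Let E_bounded u : exists M, forall x, C x -> `|E u x| <= M.
Proof.
exists (expR (\sum_j `|u.1 j| + `|u.2|)) => x Cx.
rewrite ger0_norm ?expR_ge0 // ler_expR (le_trans (ler_norm _)) //.
exact: ridge_arg_bound.
Qed.

Let E_mul u v : exists k, forall x, E u x * E v x = E k x.
Proof.
exists (fun j => u.1 j + v.1 j, u.2 + v.2) => x.
rewrite /E /ridge -expRD /=; congr expR.
rewrite addrACA -big_split /=; congr (_ + _).
by apply: eq_bigr => j _; rewrite mulrDl.
Qed.

Let E_one : exists u, forall x, E u x = 1.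
Proof.
exists (fun=> 0, 0) => x; rewrite /E /ridge /= big1 ?addr0 ?expR0 // => j _.
by rewrite mul0r.
Qed.

(** [expR] has nonzero derivative at 0, so a small multiple of one coordinate in the exponent
    recovers that coordinate. *)
Lemma cspan_coord j : cspan C E (fun x => x ord0 j).
Proof.
apply: cspan_closed => e e0.
have [] := @derivable_recovers_id expR 0 _ _ 1 e ltr01 e0.
- exact: derivable_expR.
- by rewrite derive1E derive_val expR0 oner_neq0.
move=> A [al [be H]].
exists (fun x => al * E (fun i => A *+ (i == j), 0) x + be); split.
  apply: cspan_lin; first exact: cspan_gen.
  exact: cspan_cst.
move=> x Cx; rewrite distrC /E /ridge /=.
rewrite (bigD1 j) //= eqxx mulr1n big1 ?addr0.
  have := H (x ord0 j); rewrite addr0; apply.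
  by have /andP[x0 x1] := Cx j; rewrite ger0_norm.
by move=> i /negPf ->; rewrite mulr0n mul0r.
Qed.

Lemma cspan_bigmax (J : Type) (r : seq J) (F0 : 'rV[R]_d -> R)
    (F : J -> 'rV[R]_d -> R) :
  cspan C E F0 -> (forall j, cspan C E (F j)) ->
  cspan C E (fun x => \big[Num.max/F0 x]_(j <- r) F j x).
Proof.
move=> H0 HF; elim: r => [|j r IHr].
  by apply: (cspan_ext H0) => x _; rewrite big_nil.
have := cspan_max E_bounded E_mul (HF j) IHr.
by move=> H; apply: (cspan_ext H) => x _; rewrite big_cons.
Qed.

Definition l1dist x y : R := \sum_j `|x ord0 j - y ord0 j|.

Lemma cspan_cone a K y : cspan C E (fun x => a - K * l1dist x y).
Proof.
apply: cspanB; first exact: cspan_cst.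
apply: cspanZ; apply: cspan_sum => j.
apply: (cspan_norm E_bounded E_mul).
by apply: cspanB; [exact: cspan_coord|exact: cspan_cst].
Qed.

Lemma unit_cube_compact : compact C.
Proof.
have -> : C = [set v | forall i, `[0, 1]%classic (v ord0 i)].
  by apply/seteqP; split=> x H i; have := H i; rewrite /= in_itv.
apply: (@rV_compact _ _ (fun=> `[(0 : R), 1]%classic)) => _.
exact: segment_compact.
Qed.

Lemma cube_near f x (e : R) : {within C, continuous f} -> C x -> 0 < e ->
  exists2 r : R, 0 < r & forall y, C y ->
    (forall j, `|x ord0 j - y ord0 j| < r) -> `|f x - f y| < e.
Proof.
move=> cf Cx e0.
have /cvgrPdist_lt/(_ e e0) H := cf x.
have {H} : @nbhs_subspace _ C x [set y | `|f x - f y| < e] by exact: H.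
rewrite -nbhs_subspace_in // => /nbhs_ballP[r /= r0 Hr].
exists r => // y Cy Hy; apply: Hr => //.
by split=> // i j; rewrite ord1; exact: Hy.
Qed.

Lemma cube_bounded f : {within C, continuous f} ->
  exists2 M : R, 0 < M & forall x, C x -> `|f x| <= M.
Proof.
move=> cf; have /compact_bounded[M [_ HM]] := continuous_compact cf unit_cube_compact.
exists (`|M| + 1); first by rewrite ltr_wpDl.
move=> x Cx; apply: HM; last by exists x.
by rewrite (le_lt_trans (ler_norm M)) // ltrDl.
Qed.

(** By compactness: half the radius at a centre absorbs the distance to [x], the other half that
    from [x] to [y]. *)
Lemma cube_unif_continuous f (e : R) : {within C, continuous f} -> 0 < e ->
  exists2 r : R, 0 < r & forall x y, C x -> C y ->
    (forall j, `|x ord0 j - y ord0 j| < r) -> `|f x - f y| < e.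
Proof.
move=> cf e0; have e2 : 0 < e / 2 by rewrite divr_gt0.
have /compact_near_coveringP H := unit_cube_compact.
pose P (r : R) x := forall y, C x -> C y ->
  (forall j, `|x ord0 j - y ord0 j| < r) -> `|f x - f y| < e.
have : \forall r \near 0^'+, C `<=` P r.
  apply: H => x Cx; have [r r0 Hr] := cube_near cf Cx e2.
  have r2 : 0 < r / 2 by rewrite divr_gt0.
  exists (ball x (r / 2), [set s : R | s < r / 2]) => /=.
    by split; [exact: nbhsx_ballx|exact: nbhs_right_lt].
  move=> [x' s] /= [[_ xx'] sr] y Cx' Cy x'y.
  have xx j : `|x ord0 j - x' ord0 j| < r / 2 by exact: xx'.
  have H1 : `|f x - f x'| < e / 2.
    by apply: Hr => // j; apply: lt_trans (xx j) _; lra.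
  have H2 : `|f x - f y| < e / 2.
    apply: Hr => // j; rewrite -(subrKA (x' ord0 j)).
    rewrite (le_lt_trans (ler_normD _ _)) // [ltRHS]splitr ltrD //.
    exact: lt_trans (x'y j) sr.
  rewrite -(subrKA (f x)) (le_lt_trans (ler_normD _ _)) // [ltRHS]splitr ltrD //.
  by rewrite distrC.
move=> Hr; have : \forall r \near 0^'+, 0 < r /\ C `<=` P r :> Prop.
  by near=> r; split; near: r => //; exact: nbhs_right_gt.
move/filter_ex => [r [r0 Pr]]; exists r => // x y Cx; exact: Pr.
Unshelve. all: by end_near.
Qed.

(** Points within the modulus [r] in every coordinate cost [e]; otherwise [l1dist x y] is at least
    [r], and the slope [2 * M / r] covers the oscillation [2 * M]. *)
Lemma cube_coarse_lipschitz f (e : R) : {within C, continuous f} -> 0 < e ->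
  exists2 K : R, 0 < K & forall x y, C x -> C y ->
    f x - f y <= e + K * l1dist x y.
Proof.
move=> cf e0; have [r r0 Hr] := cube_unif_continuous cf e0.
have [M M0 HM] := cube_bounded cf.
exists (2 * M / r); first by rewrite divr_gt0 // mulr_gt0.
have K0 : 0 <= 2 * M / r by rewrite divr_ge0 ?mulr_ge0 // ltW.
have l0 x y : 0 <= l1dist x y by apply: sumr_ge0.
move=> x y Cx Cy; have [H|] := pselect (forall j, `|x ord0 j - y ord0 j| < r).
  rewrite (le_trans (ler_norm _)) // (le_trans (ltW (Hr _ _ Cx Cy H))) //.
  by rewrite lerDl mulr_ge0.
move=> /existsNP[j /negP]; rewrite -leNgt => rj.
have rl : r <= l1dist x y.
  by apply: (le_trans rj); rewrite /l1dist (bigD1 j) //= lerDl sumr_ge0.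
have H : 2 * M <= 2 * M / r * l1dist x y.
  by rewrite -{1}(divfK (lt0r_neq0 r0) (2 * M)) ler_wpM2l.
have := HM _ Cx; have := HM _ Cy; rewrite !ler_norml.
by move=> /andP[a1 a2] /andP[b1 b2]; lra.
Qed.

Lemma cube_grid (e : R) : 0 < e ->
  exists (J : finType) (p : J -> 'rV[R]_d), (forall i, C (p i)) /\
    forall x, C x -> exists i, l1dist x (p i) <= e.
Proof.
move=> e0; pose N := Num.bound (d%:R / e).
have dN : d%:R / e < N%:R :> R by apply: archi_boundP; rewrite divr_ge0 // ltW.
have N0 : 0 < N%:R :> R by apply: le_lt_trans dN; rewrite divr_ge0 // ltW.
exists {ffun 'I_d -> 'I_N.+1},
  (fun i : {ffun 'I_d -> 'I_N.+1} => \row_j ((i j : nat)%:R / N%:R)); split.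
  move=> i j; rewrite mxE divr_ge0 //= ler_pdivrMr // mul1r ler_nat.
  by rewrite -ltnS.
move=> x Cx; exists [ffun j => inord (Num.truncn (N%:R * x ord0 j))].
apply: (@le_trans _ _ (\sum_(j < d) N%:R^-1)).
  apply: ler_sum => j _; rewrite mxE ffunE; have /andP[x0 x1] := Cx j.
  have /truncn_itv/andP[] : 0 <= N%:R * x ord0 j by rewrite mulr_ge0 // ltW.
  set m := Num.truncn _ => m1 m2.
  have mN : (m < N.+1)%N.
    by rewrite ltnS -(ler_nat R) (le_trans m1) // ler_piMr // ltW.
  rewrite inordK //.
  have -> : x ord0 j - m%:R / N%:R = (N%:R * x ord0 j - m%:R) / N%:R.
    by field; rewrite lt0r_neq0.
  rewrite normrM normfV (gtr0_norm N0) ler_piMl ?invr_ge0 ?(ltW N0) //.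
  rewrite ger0_norm ?subr_ge0 //.
  by move: m2; rewrite -natr1; lra.
rewrite sumr_const card_ord -[leLHS]mulr_natl ler_pdivrMr //.
by move: dN; rewrite ltr_pdivrMr // mulrC => /ltW.
Qed.

(* [f] is a uniform limit of finite maxima of the cones [f y - K * |x - y|_1]. *)
Lemma cspan_continuous f : {within C, continuous f} -> cspan C E f.
Proof.
move=> cf; apply: cspan_closed => e e0.
have e2 : 0 < e / 2 by rewrite divr_gt0.
have [K K0 HK] := cube_coarse_lipschitz cf e2.
(* Near a grid point, its cone falls below [f x] by at most [e / 2] from [HK] plus twice [e / 4]. *)
have eK : 0 < e / 2 / (2 * K) by rewrite divr_gt0 // mulr_gt0.
have [J [p [Cp Hp]]] := cube_grid eK.
have l1C x y : l1dist x y = l1dist y x.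
  by apply: eq_bigr => j _; rewrite distrC.
have [M M0 HM] := cube_bounded cf.
(* The starting value [- M] lies below [f], so the maximum keeps its upper bound. *)
exists (fun x => \big[Num.max/- M]_(i : J) (f (p i) - K * l1dist x (p i))); split.
  by apply: cspan_bigmax => [|j]; [exact: cspan_cst|exact: cspan_cone].
move=> x Cx.
have ub : \big[Num.max/- M]_(i : J) (f (p i) - K * l1dist x (p i)) <= f x + e / 2.
  apply: bigmax_le => [|i _].
    by have := HM _ Cx; rewrite ler_norml => /andP[? _]; lra.
  by have := HK (p i) x (Cp i) Cx; rewrite l1C; lra.
have [i Hi] := Hp x Cx.
have lb := @le_bigmax _ R J (- M) (fun i => f (p i) - K * l1dist x (p i)) i.
have := HK x (p i) Cx (Cp i).
have : K * l1dist x (p i) <= e / 2 / 2.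
  by move: Hi; rewrite ler_pdivlMr ?mulr_gt0 //; lra.
rewrite ler_norml; move: lb ub; lra.
Qed.

End Exponentials.

(** Exponential ridges reduce to powers of their bounded argument, and these to [s] of affine
    functions of it, which are again ridges of [s]. *)
Lemma cspan_ridge_continuous (s : R -> R) f :
  lipschitz_fun s -> ~ affine_fun s ->
  {within @unit_cube R d, continuous f} -> cspan (@unit_cube R d) (ridge s) f.
Proof.
move=> sL sA /cspan_continuous; apply: (cspan_comp (phi := id)) => // -[w b].
pose M := \sum_j `|w j| + `|b| + 1.
have M0 : 0 < M by rewrite ltr_wpDl // addr_ge0 // sumr_ge0.
apply: (cspan_comp (phi := fun x => \sum_j w j * x ord0 j + b) _ _ (cspan_expR M)).
  move=> x Cx /=; apply: (le_trans (ridge_arg_bound w b Cx)).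
  by rewrite /M lerDl.
move=> k.
apply: (cspan_comp (phi := fun x => \sum_j w j * x ord0 j + b) (C := [set t | `|t| <= M])
  _ _ (cspan_monomial k M0 sL sA)).
  move=> x Cx /=; apply: (le_trans (ridge_arg_bound w b Cx)).
  by rewrite /M lerDl.
move=> [a c] /=.
apply: (cspan_ext (cspan_gen _ _ (fun j => a * w j, a * b + c))) => x _.
rewrite /ridge /= mulrDr addrA mulr_sumr; congr (s (_ + _ + _)).
by apply: eq_bigr => j _; rewrite mulrA.
Qed.

End Cube.

(** * Emulating a shallow network by a deep narrow one *)

Section Network.
Context {R : realType}.

(* [neuron s F]: a unit [s] with affine pre- and post-processing computes the
   Lipschitz function [F] on bounded sets, robustly in its input. *)
Definition neuron (s F : R -> R) : Prop := lipschitz_fun F /\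
  forall M e : R, 0 < M -> 0 < e ->
  exists u : R * (R * R) * (R * R), 0 < u.1.1 /\
    forall t t', `|t| <= M -> `|t' - t| <= u.1.1 ->
      `|u.2.1 * s (u.1.2.1 * t' + u.1.2.2) + u.2.2 - F t| <= e.

Lemma neuron_self (s : R -> R) : lipschitz_fun s -> neuron s s.
Proof.
move=> sL; split=> // M e _ e0; have [K K0 HK] := lipschitz_fun_ge0 sL.
have K1 : 0 < K + 1 by rewrite ltr_wpDl.
exists (e / (K + 1), (1, 0), (1, 0)) => /=; split; first by rewrite divr_gt0.
move=> t t' _ tt'; rewrite !mul1r !addr0 (le_trans (HK _ _)) //.
apply: (le_trans (ler_wpM2l K0 tt')).
by rewrite mulrA ler_pdivrMr // mulrDr mulr1 mulrC lerDl ltW.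
Qed.

(** The identity is approximated on the larger radius [M + 1], since a perturbed input may leave
    [M]; half of [e] is kept for the perturbation. *)
Lemma neuron_id (s : R -> R) (x0 : R) :
  derivable s x0 1 -> s^`()%classic x0 != 0 -> neuron s id.
Proof.
move=> ds D0; split=> [|M e M0 e0]; first by exists 1 => x y; rewrite mul1r.
have M1 : 0 < M + 1 by rewrite addr_gt0.
have e2 : 0 < e / 2 by rewrite divr_gt0.
have [A [al [be H]]] := derivable_recovers_id ds D0 M1 e2.
exists (Num.min 1 (e / 2), (A, x0), (al, be)) => /=.
split; first by rewrite lt_min ltr01.
move=> t t' tM; rewrite le_min => /andP[t1 t2].
rewrite -(subrKA t') (le_trans (ler_normD _ _)) // [leRHS]splitr lerD // H //.
rewrite -(subrK t t') (le_trans (ler_normD _ _)) // addrC lerD //.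
Qed.

Lemma lipschitz_bounded (F : R -> R) (M : R) : lipschitz_fun F ->
  exists2 N, 0 < N & forall t, `|t| <= M -> `|F t| <= N.
Proof.
move=> /lipschitz_fun_ge0[K K0 HK]; exists (K * `|M| + `|F 0| + 1).
  by rewrite ltr_wpDl // addr_ge0 // mulr_ge0.
move=> t tM; rewrite -[F t](subrK (F 0)) (le_trans (ler_normD _ _)) //.
rewrite -addrA lerD //; last by rewrite lerDl.
rewrite (le_trans (HK _ _)) // subr0 ler_wpM2l // (le_trans tM) //.
exact: ler_norm.
Qed.

Context {d p : nat}.
Variables (B : 'I_d -> 'I_p -> nat -> R -> R) (sigma : R -> R).
Hypothesis hB : forall j k, basis_functions (B j k).
Implicit Types (F : 'I_p -> 'rV[R]_d -> R) (m : nat).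
Let C := @unit_cube R d.

(** Depth [m] reads parameters of index at most [m.+1], so adding a layer leaves the network below
    intact. *)
Lemma hdann1_layer_eq q c W W' bias bias' x m :
  (forall l, (l <= m.+1)%N -> W l = W' l /\ bias l = bias' l) ->
  hdann1_layer sigma B q c W bias x m = hdann1_layer sigma B q c W' bias' x m.
Proof.
elim: m => [|m IHm] H /=; apply/funext => k.
  by rewrite (H 1%N isT).2.
rewrite (H m.+2 (leqnn _)).1 (H m.+2 (leqnn _)).2 IHm // => l lm.
by apply: H; exact: leqW.
Qed.

(* Up to an affine change of coordinates in each unit, layer [m.+1] of some
   network is uniformly as close as desired to the functions [F]. *)
Definition emulates m F : Prop :=
  (forall k, exists2 M, 0 < M & forall x, C x -> `|F k x| <= M) /\
  forall e : R, 0 < e -> exists q c W bias (al be : 'I_p -> R),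
    (forall j k, (1 <= q j k)%N) /\ forall x k, C x ->
      `|al k * hdann1_layer sigma B q c W bias x m k + be k - F k x| <= e.

(** The constant [u.2] is kept apart because it must be moved into the bias of the first layer. *)
Lemma basis_approx j k (a e : R) : 0 < e -> exists u : nat * (nat -> R) * R,
  (1 <= u.1.1)%N /\ forall t, 0 <= t <= 1 ->
    `|\sum_(1 <= r < u.1.1.+1) u.1.2 r * B j k r t + u.2 - a * t| <= e.
Proof.
move=> e0; have cphi : {within @unit_interval R, continuous (fun t : R => a * t)}.
  apply: continuous_subspaceT => t.
  by apply: cvgM; [exact: cvg_cst|exact: cvg_id].
have [q [q1 [c [c0 H]]]] := hB j k cphi e0.
exists (q, c, c0); split=> // t t01 /=; rewrite distrC -lee_fin.
apply: le_trans (ltW H); apply: ereal_sup_ubound.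
by exists t.
Qed.

Lemma affine_bounded (I : finType) (T : Type) (D : set T) (F : I -> T -> R)
    (a : I -> R) (b : R) :
  (forall i, exists2 M, 0 < M & forall x, D x -> `|F i x| <= M) ->
  exists2 M, 0 < M & forall x, D x -> `|\sum_i a i * F i x + b| <= M.
Proof.
move=> HF; have /choice[M HM] : forall i, exists M, 0 < M /\
    forall x, D x -> `|F i x| <= M.
  by move=> i; have [M ? ?] := HF i; exists M.
exists (\sum_i `|a i| * M i + `|b| + 1).
  rewrite ltr_wpDl // addr_ge0 // sumr_ge0 // => i _.
  by rewrite mulr_ge0 // ltW //; have [] := HM i.
move=> x Dx; rewrite (le_trans (ler_normD _ _)) // -addrA lerD ?lerDl //.
rewrite (le_trans (ler_norm_sum _ _ _)) //; apply: ler_sum => i _.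
by rewrite normrM ler_wpM2l //; have [_] := HM i; exact.
Qed.

(** The inner affine map of each neuron goes into [c] and the first bias, and its input tolerance is
    shared among the [d] coordinates; the outer map stays in [al] and [be]. *)
Lemma emulates_first (Phi : 'I_p -> R -> R) (a : 'I_p -> 'I_d -> R)
    (b : 'I_p -> R) F :
  (forall k, neuron sigma (Phi k)) ->
  (forall k x, F k x = Phi k (\sum_j a k j * x ord0 j + b k)) -> emulates 0 F.
Proof.
move=> HPhi FE.
have vB k : exists2 M, 0 < M &
    forall x, C x -> `|\sum_j a k j * x ord0 j + b k| <= M.
  apply: (@affine_bounded _ _ C (fun j x => x ord0 j)) => j; exists 1 => // x Cx.
  by have /andP[x0 x1] := Cx j; rewrite ger0_norm.
split=> [k|e e0].
  have [M M0 HM] := vB k; have [N N0 HN] := lipschitz_bounded M (HPhi k).1.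
  by exists N => // x Cx; rewrite FE HN // HM.
have /choice[u Hu] : forall k, exists u : R * (R * R) * (R * R), 0 < u.1.1 /\
    forall x t', C x -> `|t' - (\sum_j a k j * x ord0 j + b k)| <= u.1.1 ->
      `|u.2.1 * sigma (u.1.2.1 * t' + u.1.2.2) + u.2.2 - F k x| <= e.
  move=> k; have [M M0 HM] := vB k; have [u [u0 H]] := (HPhi k).2 M e M0 e0.
  by exists u; split=> // x t' Cx; rewrite FE; apply: H; exact: HM.
have d1 : 0 < d%:R + 1 :> R by rewrite ltr_wpDl.
have /choice[v Hv] : forall jk : 'I_d * 'I_p, exists v : nat * (nat -> R) * R,
    (1 <= v.1.1)%N /\ forall t, 0 <= t <= 1 ->
    `|\sum_(1 <= r < v.1.1.+1) v.1.2 r * B jk.1 jk.2 r t + v.2 - a jk.2 jk.1 * t|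
      <= (u jk.2).1.1 / (d%:R + 1).
  move=> [j k]; apply: basis_approx; rewrite divr_gt0 //.
  by have [] := Hu k.
exists (fun j k => (v (j, k)).1.1),
  (fun j k r => (u k).1.2.1 * (v (j, k)).1.2 r), (fun _ _ _ => 0),
  (fun _ k => (u k).1.2.1 * (\sum_j (v (j, k)).2 + b k) + (u k).1.2.2),
  (fun k => (u k).2.1), (fun k => (u k).2.2).
split=> [j k|x k Cx /=]; first by have [] := Hv (j, k).
have [u0 Huk] := Hu k.
pose t' := \sum_j (\sum_(1 <= r < (v (j, k)).1.1.+1)
   (v (j, k)).1.2 r * B j k r (x ord0 j) + (v (j, k)).2) + b k.
have := Huk x t' Cx.
have -> : (u k).1.2.1 * t' + (u k).1.2.2 =
  \sum_(j < d) \sum_(1 <= r < (v (j, k)).1.1.+1)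
    (u k).1.2.1 * (v (j, k)).1.2 r * B j k r (x ord0 j) +
  ((u k).1.2.1 * (\sum_j (v (j, k)).2 + b k) + (u k).1.2.2).
  rewrite /t' big_split /= [RHS]addrA; congr (_ + _).
  rewrite -addrA [LHS]mulrDr; congr (_ + _).
  rewrite mulr_sumr; apply: eq_bigr => j _; rewrite mulr_sumr.
  by apply: eq_bigr => r _; rewrite mulrA.
apply; rewrite /t' opprD addrACA subrr addr0 -sumrB.
rewrite (le_trans (ler_norm_sum _ _ _)) //.
apply: (@le_trans _ _ (\sum_(j < d) (u k).1.1 / (d%:R + 1))).
  by apply: ler_sum => j _; apply: (Hv (j, k)).2; exact: Cx.
rewrite sumr_const card_ord -[leLHS]mulr_natl mulrA ler_pdivrMr // mulrC.
by rewrite ler_pM2l // lerDl.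
Qed.

(** The pending outer maps [al], [be] of the layer below are folded into the weights and bias of the
    new one. *)
Lemma emulates_next m (Phi : 'I_p -> R -> R) (a : 'I_p -> 'I_p -> R)
    (b : 'I_p -> R) F F' :
  (forall k, neuron sigma (Phi k)) ->
  (forall k x, F' k x = Phi k (\sum_i a k i * F i x + b k)) ->
  emulates m F -> emulates m.+1 F'.
Proof.
move=> HPhi FE [FB HF].
have vB k : exists2 M, 0 < M &
    forall x, C x -> `|\sum_i a k i * F i x + b k| <= M.
  exact: affine_bounded.
split=> [k|e e0].
  have [M M0 HM] := vB k; have [N N0 HN] := lipschitz_bounded M (HPhi k).1.
  by exists N => // x Cx; rewrite FE HN // HM.
have /choice[u Hu] : forall k, exists u : R * (R * R) * (R * R), 0 < u.1.1 /\
    forall x t', C x -> `|t' - (\sum_i a k i * F i x + b k)| <= u.1.1 ->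
      `|u.2.1 * sigma (u.1.2.1 * t' + u.1.2.2) + u.2.2 - F' k x| <= e.
  move=> k; have [M M0 HM] := vB k; have [u [u0 H]] := (HPhi k).2 M e M0 e0.
  by exists u; split=> // x t' Cx; rewrite FE; apply: H; exact: HM.
(* One accuracy of the layer below that suits all units; the [+ 1] keeps denominators positive. *)
pose r := \big[Num.min/1]_k ((u k).1.1 / (\sum_i `|a k i| + 1)).
have a1 k : 0 < \sum_i `|a k i| + 1 by rewrite ltr_wpDl // sumr_ge0.
have r0 : 0 < r.
  by apply: lt_bigmin => // k _; rewrite divr_gt0 //; have [] := Hu k.
have [q [c [W [bias [al [be [q1 H]]]]]]] := HF r r0.
(* Depth is counted from 0 and parameters from 1, so the new layer at depth [m.+1] owns index
   [m.+2]. *)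
exists q, c, (fun l k i => if l == m.+2 then (u k).1.2.1 * (a k i * al i) else W l k i),
  (fun l k => if l == m.+2 then
     (u k).1.2.1 * (\sum_i a k i * be i + b k) + (u k).1.2.2 else bias l k),
  (fun k => (u k).2.1), (fun k => (u k).2.2).
split=> // x k Cx /=; rewrite eqxx.
rewrite -(@hdann1_layer_eq q c W _ bias); last first.
  move=> l lm; have /negPf -> // : l != m.+2.
  by rewrite neq_ltn ltnS lm.
have [u0 Huk] := Hu k.
pose t' := \sum_i a k i * (al i * hdann1_layer sigma B q c W bias x m i + be i) + b k.
have := Huk x t' Cx.
have -> : (u k).1.2.1 * t' + (u k).1.2.2 =
  \sum_(i < p) (u k).1.2.1 * (a k i * al i) * hdann1_layer sigma B q c W bias x m i +
  ((u k).1.2.1 * (\sum_i a k i * be i + b k) + (u k).1.2.2).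
  rewrite /t' addrA; congr (_ + _).
  rewrite !mulrDr !addrA; congr (_ + _).
  rewrite !mulr_sumr -big_split /=; apply: eq_bigr => i _; ring.
apply; rewrite /t' opprD addrACA subrr addr0 -sumrB.
rewrite (le_trans (ler_norm_sum _ _ _)) //.
apply: (@le_trans _ _ (\sum_i `|a k i| * r)).
  by apply: ler_sum => i _; rewrite -mulrBr normrM ler_wpM2l // H.
rewrite -mulr_suml.
have rk : r * (\sum_i `|a k i| + 1) <= (u k).1.1.
  rewrite -ler_pdivlMr //.
  exact: (@bigmin_le _ R _ 1 k (fun k => (u k).1.1 / (\sum_i `|a k i| + 1))).
by apply: le_trans rk; rewrite mulrC ler_pM2l // lerDl.
Qed.

End Network.

(** * Adding one ridge term per layer *)

Section Registers.
Context {R : realType} {d n : nat}.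
Local Notation osplit := fintype.split.
Local Notation p := (d + n.+2)%N.
Variables (B : 'I_d -> 'I_p -> nat -> R -> R) (sigma : R -> R).
Hypothesis hB : forall j k, basis_functions (B j k).
Hypothesis sigma_self : neuron sigma sigma.
Hypothesis sigma_id : neuron sigma id.
Local Notation ridge := (@ridge R d sigma).
Local Notation term := (R * (('I_d -> R) * R))%type.

Definition shallow (ts : seq term) (x : 'rV[R]_d) : R :=
  \sum_(v <- ts) v.1 * ridge v.2 x.

(* Registers: the coordinates of [x], one ridge term, the partial sum, and
   idle units. *)
Definition registers (ts : seq term) u (k : 'I_p) (x : 'rV[R]_d) : R :=
  match osplit k with
  | inl j => x ord0 j
  | inr i => match val i with
             | 0%N => ridge u x
             | 1%N => shallow ts x
             | _ => 0
             end
  end.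

Let act (k : 'I_p) : R -> R :=
  if osplit k is inr i then if val i == 0%N then sigma else id else id.

Let bias (u : ('I_d -> R) * R) (k : 'I_p) : R :=
  if osplit k is inr i then if val i == 0%N then u.2 else 0 else 0.

Let coord_coef (u : ('I_d -> R) * R) (k : 'I_p) (j : 'I_d) : R :=
  match osplit k with
  | inl j' => (j == j')%:R
  | inr i => if val i == 0%N then u.1 j else 0
  end.

(** Only the accumulator, unit 1 of the second block, reads that block: it adds [v.1] times the
    stored term to the stored sum. *)
Let coef (v : term) u (k i : 'I_p) : R :=
  match osplit i with
  | inl j => coord_coef u k j
  | inr i' =>
    if osplit k is inr k' then
      if val k' == 1%N then
        match val i' with 0%N => v.1 | 1%N => 1 | _ => 0 end
      else 0
    else 0
  end.

Let act_neuron k : neuron sigma (act k).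
Proof. by rewrite /act; case: osplit => [//|i]; case: ifP. Qed.

Let coord_sum u k (x : 'rV[R]_d) : \sum_j coord_coef u k j * x ord0 j =
  match osplit k with
  | inl j => x ord0 j
  | inr i => if val i == 0%N then \sum_j u.1 j * x ord0 j else 0
  end.
Proof.
rewrite /coord_coef; case: osplit => [j|i].
  rewrite (bigD1 j) //= eqxx mul1r big1 ?addr0 // => j' /negPf ->.
  by rewrite mul0r.
by case: ifP => // _; rewrite big1 // => j _; rewrite mul0r.
Qed.

Let registers_first u k x :
  registers [::] u k x = act k (\sum_j coord_coef u k j * x ord0 j + bias u k).
Proof.
rewrite coord_sum /registers /act /bias; case: osplit => [j|i].
  by rewrite addr0.
case: (val i) => [|[|m]] /=; rewrite ?addr0 //.
by rewrite /shallow big_nil.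
Qed.

Let registers_next ts v u k x :
  registers (v :: ts) u k x =
  act k (\sum_i coef v u k i * registers ts v.2 i x + bias u k).
Proof.
have spl j : osplit (lshift n.+2 j) = inl j := unsplitK (inl j).
have spr i : osplit (rshift d i) = inr i := unsplitK (inr i).
have -> : \sum_i coef v u k i * registers ts v.2 i x =
    \sum_j coord_coef u k j * x ord0 j +
    if osplit k is inr i then
      if val i == 1%N then shallow (v :: ts) x else 0
    else 0.
  rewrite big_split_ord /=; congr (_ + _).
    by apply: eq_bigr => j _; rewrite /coef /registers spl.
  under eq_bigr do rewrite /coef /registers spr.
  case: osplit => [j|i]; first by rewrite big1 // => i _; rewrite mul0r.
  case: ifP => _; last by rewrite big1 // => i' _; rewrite mul0r.
  rewrite 2!big_ord_recl big1 ?addr0 /= => [|i' _]; last by rewrite mul0r.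
  by rewrite mul1r /shallow big_cons.
rewrite coord_sum /registers /act /bias; case: osplit => [j|i].
  by rewrite !addr0.
by case: (val i) => [|[|m]] /=; rewrite ?add0r ?addr0.
Qed.

(** A term is stored one layer before it is added, so the induction hypothesis is used with [v.2] in
    place of [u]. *)
Lemma emulates_registers ts u : emulates B sigma (size ts) (registers ts u).
Proof.
elim: ts u => [|v ts IHts] u.
  exact: (emulates_first hB act_neuron (registers_first u)).
exact: (emulates_next act_neuron (registers_next ts v u) (IHts v.2)).
Qed.

Lemma hdann1_shallow ts (e : R) : 0 < e ->
  exists q c W bs w b, (forall j k, (1 <= q j k)%N) /\
    forall x, @unit_cube R d x ->
      `|HDANN1 sigma B (size ts).+1 q c W bs w b x - shallow ts x| <= e.
Proof.
(* The sum is complete at this depth, so the term register holds a dummy ridge. *)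
move=> e0; have [_ H] := emulates_registers ts (fun=> 0, 0).
have [q [c [W [bs [al [be [q1 {}H]]]]]]] := H e e0.
pose k : 'I_p := rshift d (Ordinal (isT : 1 < n.+2)%N).
(* The accumulator's outer affine map becomes the output weight and bias. *)
exists q, c, W, bs, (fun i => if i == k then al k else 0), (be k).
split=> // x Cx; have := H x k Cx.
rewrite /registers (unsplitK (inr _)) /HDANN1 /= (bigD1 k) //= eqxx big1 ?addr0 //.
by move=> i /negPf ->; rewrite mul0r.
Qed.

End Registers.

Theorem theorem2 (R : realType) (d p : nat) (hd : (1 <= d)%N) (hp : (d + 3 <= p)%N)
  (B : 'I_d -> 'I_p -> nat -> R -> R)
  (hB : forall j k, basis_functions (B j k))
  (sigma : R -> R)
  (hs_naff : ~ affine_fun sigma)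
  (hs_lip : lipschitz_fun sigma)
  (hs_C1 : C1_at_nonzero_deriv sigma)
  (f : 'rV[R]_d -> R)
  (hf : {within @unit_cube R d, continuous f})
  (eps : R) (heps : 0 < eps) :
  exists (L : nat) (q : 'I_d -> 'I_p -> nat) (c : 'I_d -> 'I_p -> nat -> R)
         (W : nat -> 'I_p -> 'I_p -> R) (bias : nat -> 'I_p -> R)
         (w : 'I_p -> R) (b : R),
    (1 <= L)%N /\ (forall j k, (1 <= q j k)%N) /\
    (sup_dist (@unit_cube R d) f (HDANN1 sigma B L q c W bias w b) < eps%:E)%E.
Proof.
have [n pE] : exists n, p = (d + n.+2)%N.
  by exists (p - (d + 2))%N; lia.
subst p; have [x0 [/nbhs_singleton ds [_ D0]]] := hs_C1.
(* Two errors of [eps / 4] bound the supremum by [eps / 2], strictly below [eps]. *)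
have e4 : 0 < eps / 4 by rewrite divr_gt0.
have [ts Hts] := cspan_finite (cspan_ridge_continuous hs_lip hs_naff hf) e4.
have [q [c [W [bs [w [b [q1 H]]]]]]] :=
  hdann1_shallow hB (neuron_self hs_lip) (neuron_id ds D0) ts e4.
exists (size ts).+1, q, c, W, bs, w, b; split=> //; split=> //.
apply: (@le_lt_trans _ _ (eps / 2)%:E); last by rewrite lte_fin; lra.
apply: ge_ereal_sup => _ [x Cx <-]; rewrite lee_fin.
rewrite -(subrKA (shallow sigma ts x)) (le_trans (ler_normD _ _)) //.
have -> : eps / 2 = eps / 4 + eps / 4 by field.
by rewrite lerD ?Hts // distrC H.
Qed.
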